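(* Suppose each $f_i$ is strongly convex with constant $\mu_i>0$, $i=1,\dots,m$, and let $\mu=\min_i\mu_i$. Then the dual function $g$ is differentiable on $\mathbb{R}^{n(m-1)}$, and its gradient $\nabla g$ is Lipschitz continuous with constant $(1/\mu)\left[2+2\cos(\pi/m)\right]$.
   Context: Let $m\ge2$, $n\ge1$ be integers, $\mathcal{Y}\subseteq\mathbb{R}^n$ a nonempty closed convex set, and $f_i:\mathbb{R}^n\to\mathbb{R}$, $i=1,\dots,m$, strictly convex closed functions. For $\mathbf{y}=(\mathbf{y}_1,\dots,\mathbf{y}_m)\in(\mathbb{R}^n)^m=\mathbb{R}^{nm}$ put $f(\mathbf{y})=\sum_{i=1}^m f_i(\mathbf{y}_i)$, and $\mathbf{A}\mathbf{y}=(\mathbf{y}_1-\mathbf{y}_2,\dots,\mathbf{y}_{m-1}-\mathbf{y}_m)\in\mathbb{R}^{n(m-1)}$. The dual function is $g(\boldsymbol{\lambda})=\inf_{\mathbf{y}\in\mathcal{Y}^m}\big[f(\mathbf{y})+\boldsymbol{\lambda}^{T}\mathbf{A}\mathbf{y}\big]$, $\boldsymbol{\lambda}\in\mathbb{R}^{n(m-1)}$. Norms are Euclidean. A function $\varphi$ is strongly convex with constant $\sigma>0$ if $\varphi-\frac{\sigma}{2}\|\cdot\|^2$ is convex. *)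

(* Defs.v *)
From HB Require Import structures.
From mathcomp Require Import all_boot all_order all_algebra.
From mathcomp Require Import all_classical all_reals all_analysis.

Set Implicit Arguments.
Unset Strict Implicit.
Unset Printing Implicit Defensive.

Import Order.TTheory GRing.Theory Num.Theory.
Import numFieldNormedType.Exports.

Local Open Scope classical_set_scope.
Local Open Scope ring_scope.

(* R^n is 'rV[R]_n. A vector y = (y_1, ..., y_m) of (R^n)^m is the matrix in
   'M[R]_(m, n) whose i-th row is y_i; indices start at 0. *)

(* [dot] and [enorm] are the inner product and the norm of R^(m n). The library
   norm `|x| on matrices is the max norm, not the Euclidean norm. *)
Definition dot (R : realType) (m n : nat) (x y : 'M[R]_(m, n)) : R :=
  \sum_i \sum_j x i j * y i j.

Definition enorm (R : realType) (m n : nat) (x : 'M[R]_(m, n)) : R :=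
  Num.sqrt (dot x x).

Definition strictly_convex (R : realType) (n : nat) (f : 'rV[R]_n -> R) : Prop :=
  forall (x y : 'rV[R]_n) (t : R), x != y -> 0 < t -> t < 1 ->
    f (t *: x + (1 - t) *: y) < t * f x + (1 - t) * f y.

Definition strongly_convex (R : realType) (n : nat) (sigma : R)
    (f : 'rV[R]_n -> R) : Prop :=
  0 < sigma /\
  convex_function setT (fun x : 'rV[R]_n => f x - sigma / 2 * enorm x ^+ 2).

(* Closed in the sense of convex analysis: the epigraph is closed. *)
Definition closed_function (R : realType) (n : nat) (f : 'rV[R]_n -> R) : Prop :=
  closed [set p : 'rV[R]_n * R | f p.1 <= p.2].

Lemma ltn_ord_pred (m : nat) (i : 'I_m.-1) : (i.+1 < m)%N.
Proof. by case: m i => [|m] [i] //=. Qed.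

Definition ord_fst (m : nat) (i : 'I_m.-1) : 'I_m := widen_ord (leq_pred m) i.
Definition ord_snd (m : nat) (i : 'I_m.-1) : 'I_m := Ordinal (ltn_ord_pred i).

Definition consecutive_diff (R : realType) (m n : nat) (y : 'M[R]_(m, n)) :
    'M[R]_(m.-1, n) :=
  \matrix_(i < m.-1) (row (ord_fst i) y - row (ord_snd i) y).

Definition separable_sum (R : realType) (m n : nat) (f : 'I_m -> 'rV[R]_n -> R)
    (y : 'M[R]_(m, n)) : R :=
  \sum_i f i (row i y).

Definition dual_function (R : realType) (m n : nat) (Y : set 'rV[R]_n)
    (f : 'I_m -> 'rV[R]_n -> R) (l : 'M[R]_(m.-1, n)) : \bar R :=
  ereal_inf [set (separable_sum f y + dot l (consecutive_diff y))%:E |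
             y in [set y : 'M[R]_(m, n) | forall i, Y (row i y)]].

Definition gradient (R : realType) (p n : nat) (g : 'M[R]_(p, n) -> R)
    (l : 'M[R]_(p, n)) : 'M[R]_(p, n) :=
  \matrix_(i, j) 'D_(delta_mx i j) g l.

Definition euclidean_lipschitz (R : realType) (p n : nat) (k : R)
    (F : 'M[R]_(p, n) -> 'M[R]_(p, n)) : Prop :=
  forall l1 l2, enorm (F l1 - F l2) <= k * enorm (l1 - l2).

(* Main.v *)
(* Write [phi_l y = f y + <l, A y>]; it is [mu]-strongly convex, so on [Y^m] it
   is bounded below and its minimizing sequences are Cauchy, with a limit
   [s l]. Passing to the limit in the strong convexity inequality gives
     [g l + mu / 2 * |s l' - s l|^2 <= g l' + <l - l', A (s l')>].
   Adding the same inequality with [l] and [l'] exchanged,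
     [mu * |s l' - s l|^2 <= <l - l', A (s l') - A (s l)>],
   so that [A (s l)] is the gradient of [g] at [l] and is Lipschitz with constant
   [|A|^2 / mu]. Finally [|A|^2] is the largest eigenvalue [2 + 2 cos (pi / m)]
   of the Laplacian of the path with [m] vertices. *)
Require Import Defs.
From HB Require Import structures.
From mathcomp Require Import all_boot all_order all_algebra.
From mathcomp Require Import all_classical all_reals all_analysis.
From mathcomp Require Import ring lra.

Set Implicit Arguments.
Unset Strict Implicit.
Unset Printing Implicit Defensive.

Import Order.TTheory GRing.Theory Num.Theory.
Import numFieldNormedType.Exports.

Local Open Scope classical_set_scope.
Local Open Scope ring_scope.

(** * Algebra of the inner product *)

Lemma dot_pairE (R : realType) (m n : nat) (x y : 'M[R]_(m, n)) :
  dot x y = \sum_p x p.1 p.2 * y p.1 p.2.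
Proof. by rewrite /dot pair_bigA. Qed.

Lemma dotC (R : realType) (m n : nat) (x y : 'M[R]_(m, n)) : dot x y = dot y x.
Proof. by rewrite !dot_pairE; apply: eq_bigr => p _; rewrite mulrC. Qed.

Lemma dotDl (R : realType) (m n : nat) (x y z : 'M[R]_(m, n)) :
  dot (x + y) z = dot x z + dot y z.
Proof.
by rewrite !dot_pairE -big_split; apply: eq_bigr => p _; rewrite mxE mulrDl.
Qed.

Lemma dotZl (R : realType) (m n : nat) (a : R) (x y : 'M[R]_(m, n)) :
  dot (a *: x) y = a * dot x y.
Proof.
by rewrite !dot_pairE mulr_sumr; apply: eq_bigr => p _; rewrite mxE mulrA.
Qed.

Lemma dotNl (R : realType) (m n : nat) (x y : 'M[R]_(m, n)) :
  dot (- x) y = - dot x y.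
Proof. by rewrite -scaleN1r dotZl mulN1r. Qed.

Lemma dotDr (R : realType) (m n : nat) (x y z : 'M[R]_(m, n)) :
  dot x (y + z) = dot x y + dot x z.
Proof. by rewrite dotC dotDl !(dotC x). Qed.

Lemma dotZr (R : realType) (m n : nat) (a : R) (x y : 'M[R]_(m, n)) :
  dot x (a *: y) = a * dot x y.
Proof. by rewrite dotC dotZl (dotC x). Qed.

Lemma dotNr (R : realType) (m n : nat) (x y : 'M[R]_(m, n)) :
  dot x (- y) = - dot x y.
Proof. by rewrite dotC dotNl (dotC x). Qed.

Lemma dot_ge0 (R : realType) (m n : nat) (x : 'M[R]_(m, n)) : 0 <= dot x x.
Proof. by rewrite dot_pairE; apply: sumr_ge0 => p _; rewrite -expr2 sqr_ge0. Qed.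

Lemma enorm_sqr (R : realType) (m n : nat) (x : 'M[R]_(m, n)) :
  enorm x ^+ 2 = dot x x.
Proof. by rewrite sqr_sqrtr ?dot_ge0. Qed.

Lemma sqr_coord_le_dot (R : realType) (m n : nat) (x : 'M[R]_(m, n)) i j :
  x i j ^+ 2 <= dot x x.
Proof.
rewrite dot_pairE (bigD1 (i, j)) //= -expr2 lerDl.
by apply: sumr_ge0 => p _; rewrite -expr2 sqr_ge0.
Qed.

(** * Convexity with a quadratic modulus *)

Lemma dot_conv (R : realType) (m n : nat) (t : R) (x y : 'M[R]_(m, n)) :
  dot (t *: x + (1 - t) *: y) (t *: x + (1 - t) *: y) =
  t * dot x x + (1 - t) * dot y y - t * (1 - t) * dot (x - y) (x - y).
Proof.
rewrite !(dotDl, dotDr, dotZl, dotZr, dotNl, dotNr) (dotC y x); ring.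
Qed.

Lemma dot_row (R : realType) (m n : nat) (x : 'M[R]_(m, n)) :
  dot x x = \sum_i dot (row i x) (row i x).
Proof.
apply: eq_bigr => i _; rewrite /dot big_ord1.
by apply: eq_bigr => j _; rewrite !mxE.
Qed.

(* For [mu = 0] this is ordinary convexity. *)
Definition convex_modulus (R : realType) (m n : nat) (mu : R)
    (F : 'M[R]_(m, n) -> R) : Prop :=
  forall (x y : 'M[R]_(m, n)) (t : R), 0 <= t -> t <= 1 ->
    F (t *: x + (1 - t) *: y) <=
    t * F x + (1 - t) * F y - mu / 2 * (t * (1 - t) * dot (x - y) (x - y)).

Lemma convex_modulusB (R : realType) (m n : nat) (mu : R)
    (F : 'M[R]_(m, n) -> R) : convex_modulus mu F ->
  convex_modulus 0 (fun x => F x - mu / 2 * dot x x).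
Proof.
move=> cF x y t t0 t1; have := cF x y t t0 t1; rewrite dot_conv; lra.
Qed.

Lemma convex_modulusD_dot (R : realType) (m n p q : nat) (mu : R)
    (F : 'M[R]_(m, n) -> R) (A : {linear 'M[R]_(m, n) -> 'M[R]_(p, q)})
    (l : 'M[R]_(p, q)) :
  convex_modulus mu F -> convex_modulus mu (fun x => F x + dot l (A x)).
Proof.
move=> cF x y t t0 t1; have := cF x y t t0 t1.
rewrite (linearD A) !(linearZ_LR A) /= (dotDr l) !(dotZr _ l); lra.
Qed.

Lemma strongly_convex_modulus (R : realType) (n : nat) (mu : R)
    (f : 'rV[R]_n -> R) : strongly_convex mu f -> convex_modulus mu f.
Proof.
move=> [_ cf] x y t t0 t1.
(* Library convexity takes its weight in an interval type, so [t] is packed there; [dot_conv] then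
   gives the exact defect of the quadratic term. *)
have t01 : Itv.spec (@Itv.num_sem R) (Itv.Real `[0%Z, 1%Z]) t.
  by rewrite /= /Itv.num_sem /= num_real in_itv /= t0 t1.
have := cf (Itv.mk t01) x y; rewrite !inE => /(_ I I).
rewrite /conv /= /conv /= /unstable.onem !enorm_sqr dot_conv /GRing.scale /=; lra.
Qed.

(** The squared norm splits over rows, so the moduli add row by row; [mus i] may be lowered to [mu]
    because the term it multiplies is nonnegative. *)
Lemma convex_modulus_separable_sum (R : realType) (m n : nat)
    (f : 'I_m -> 'rV[R]_n -> R) (mus : 'I_m -> R) (mu : R) :
  (forall i, convex_modulus (mus i) (f i)) -> (forall i, mu <= mus i) ->
  convex_modulus mu (separable_sum f).
Proof.
move=> cf lemu x y t t0 t1.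
rewrite /separable_sum dot_row !mulr_sumr -sumrN -!big_split /=.
apply: ler_sum => i _.
have -> : row i (t *: x + (1 - t) *: y) = t *: row i x + (1 - t) *: row i y.
  by rewrite linearD !linearZ.
have -> : row i (x - y) = row i x - row i y by rewrite linearB.
apply: (le_trans (cf i _ _ _ t0 t1)); rewrite lerD2l lerN2.
rewrite ler_wpM2r ?ler_pM2r ?invr_gt0 ?ltr0n//.
by rewrite !mulr_ge0 ?dot_ge0// subr_ge0.
Qed.

(* Convexity of the perspective function [(a, x) |-> a * h (a^-1 *: x)]. *)
Lemma convex_perspective (R : realType) (m n : nat) (h : 'M[R]_(m, n) -> R)
    (a b : R) (x e : 'M[R]_(m, n)) :
  convex_modulus 0 h -> 0 < a -> 0 <= b ->
  (a + b) * h ((a + b)^-1 *: (x + b *: e)) <= a * h (a^-1 *: x) + b * h e.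
Proof.
move=> ch a0 b0; have ab0 : 0 < a + b by lra.
have t0 : 0 <= a / (a + b) by rewrite divr_ge0 // ltW.
have t1 : a / (a + b) <= 1 by rewrite ler_pdivrMr// mul1r lerDl.
have := ch (a^-1 *: x) e _ t0 t1.
have -> : 1 - a / (a + b) = b / (a + b) by field; rewrite gt_eqF.
have -> : (a / (a + b)) *: (a^-1 *: x) + (b / (a + b)) *: e =
          (a + b)^-1 *: (x + b *: e).
  rewrite scalerDr !scalerA; congr (_ *: _ + _ *: _); last by rewrite mulrC.
  by field; rewrite !gt_eqF.
rewrite !mul0r subr0 -(ler_pM2l ab0) => /le_trans; apply.
by rewrite le_eqVlt; apply/orP; left; apply/eqP; field; rewrite gt_eqF.
Qed.

(** * Largest eigenvalue of the path Laplacian *)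

Lemma sin_gt0_shift (R : realType) (k i : nat) : (i < k)%N ->
  0 < sin ((i%:R + 2^-1) * (pi / k%:R)) :> R.
Proof.
move=> ik; have k0 : 0 < k%:R :> R by rewrite ltr0n (leq_trans _ ik).
have pi0 := pi_gt0 R; have i0 := ler0n R i.
have ik1 : i%:R + 1 <= k%:R :> R by rewrite natr1 ler_nat.
apply: sin_gt0_pi; apply/andP; split.
  by rewrite mulr_gt0 ?divr_gt0 //; lra.
by rewrite mulrCA gtr_pMr // ltr_pdivrMr //; lra.
Qed.

(* The vector [v i = sin ((i + 1/2) pi / (k + 1))], up to the signs [(-1)^i],
   is the eigenvector of the path Laplacian for its largest eigenvalue. The
   weights [v (i+1) / v i] in [-2 a b <= (v'/v) a^2 + (v/v') b^2] make all the
   coefficients of the sum equal to that eigenvalue; the two end terms fit in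
   because [v (-1) = - v 0] and [v (k+1) = - v k]. *)
Lemma sum_sqr_diff_le (R : realType) (k : nat) (a : nat -> R) :
  \sum_(i < k) (a i - a i.+1) ^+ 2 <=
  (2 + 2 * cos (pi / k.+1%:R)) * \sum_(i < k.+1) a i ^+ 2.
Proof.
set th : R := pi / k.+1%:R.
pose v (i : nat) : R := sin ((i%:R + 2^-1) * th).
(* [u i] stands for [v (i - 1)], including the value at [-1]. *)
pose u (i : nat) : R := sin ((i%:R - 2^-1) * th).
have uS i : u i.+1 = v i by rewrite /u /v -natr1; congr (sin (_ * _)); lra.
have v_gt0 i : (i < k.+1)%N -> 0 < v i by exact: sin_gt0_shift.
have u0 : u 0%N = - v 0%N by rewrite /u /v -sinN; congr sin; rewrite /=; lra.
have vk : v k.+1 = - v k.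
  have e : (k.+1%:R + 2^-1) * th = pi + 2^-1 * th.
    by rewrite mulrDl /th mulrCA divff ?mulr1 ?pnatr_eq0.
  have e' : (k%:R + 2^-1) * th = pi - 2^-1 * th.
    by move: e; rewrite -natr1; lra.
  by rewrite /v e e' addrC sinDpi addrC sinDpi sinN opprK.
have uv i : v i.+1 + u i = 2 * cos th * v i.
  have -> : v i.+1 = sin ((i%:R + 2^-1) * th + th).
    by rewrite /v -natr1; congr sin; lra.
  have -> : u i = sin ((i%:R + 2^-1) * th - th) by congr sin; lra.
  by rewrite sinB sinD /v; lra.
(* [c i] and [d i] are the weights that the edges to the next and from the previous vertex put on
   [a i ^+ 2]; by [uv] they add up to [2 + 2 * cos th]. The missing edges at the two ends correspond
   to [c k = 0] and [d 0 = 0]. *)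
pose c i := 1 + v i.+1 / v i; pose d i := 1 + u i / v i.
have v_neq0 i : (i < k.+1)%N -> v i != 0 by move=> ik; rewrite gt_eqF // v_gt0.
have -> : (2 + 2 * cos th) * \sum_(i < k.+1) a i ^+ 2 =
    \sum_(i < k.+1) c i * a i ^+ 2 + \sum_(i < k.+1) d i * a i ^+ 2.
  rewrite mulr_sumr -big_split /=; apply: eq_bigr => i _.
  rewrite -mulrDl /c /d; congr (_ * _).
  have -> : 2 * cos th = (v i.+1 + u i) / v i by rewrite uv mulfK // v_neq0.
  by rewrite mulrDl; ring.
rewrite big_ord_recr /= big_ord_recl /=.
have -> : c k = 0 by rewrite /c vk mulNr divff ?subrr // v_neq0.
have -> : d 0%N = 0 by rewrite /d u0 mulNr divff ?subrr // v_neq0.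
rewrite !mul0r addr0 add0r -big_split /=; apply: ler_sum => i _.
rewrite /bump /= add1n /c /d uS.
have vi := v_gt0 _ (ltnW (ltn_ord i)); have vi1 : 0 < v i.+1 by apply: v_gt0; rewrite ltnS.
move: (v i) (v i.+1) vi vi1 (a i) (a i.+1) => p q p0 q0 x y.
rewrite -subr_ge0.
have -> : (1 + q / p) * x ^+ 2 + (1 + p / q) * y ^+ 2 - (x - y) ^+ 2 =
          (q * x + p * y) ^+ 2 / (p * q) by field; rewrite !gt_eqF.
by rewrite divr_ge0 ?sqr_ge0 ?mulr_ge0 ?ltW.
Qed.

(** Coordinates decouple: exchanging the sums leaves one scalar path inequality per column [j]. *)
Lemma dot_consecutive_diff_le (R : realType) (m n : nat) (y : 'M[R]_(m, n)) :
  (0 < m)%N ->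
  dot (consecutive_diff y) (consecutive_diff y) <=
  (2 + 2 * cos (pi / m%:R)) * dot y y.
Proof.
case: m y => // k y _; rewrite /dot exchange_big /= [in leRHS]exchange_big /=.
rewrite mulr_sumr; apply: ler_sum => j _.
pose a i := y (inord i) j.
have -> : \sum_(i < k) consecutive_diff y i j * consecutive_diff y i j =
          \sum_(i < k) (a i - a i.+1) ^+ 2.
  apply: eq_bigr => i _; rewrite !mxE -expr2; congr ((y _ _ - y _ _) ^+ 2).
    by apply: val_inj; rewrite /= inordK // ltnS ltnW.
  by apply: val_inj; rewrite /= inordK // ltnS.
have -> : \sum_(i < k.+1) y i j * y i j = \sum_(i < k.+1) a i ^+ 2.
  by apply: eq_bigr => i _; rewrite /a inord_val expr2.
exact: sum_sqr_diff_le.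
Qed.

Lemma consecutive_diff_is_linear (R : realType) (m n : nat) :
  linear (@consecutive_diff R m n).
Proof.
move=> a x y; apply/matrixP => i j; rewrite !mxE; ring.
Qed.

HB.instance Definition _ (R : realType) (m n : nat) :=
  GRing.isLinear.Build R 'M[R]_(m, n) 'M[R]_(m.-1, n) _ (@consecutive_diff R m n)
    (@consecutive_diff_is_linear R m n).

(** * Lower bounds for strongly convex functions *)

(* Jensen's inequality for [0 = (y - \sum_p y_p e_p) / (1 + \sum_p |y_p|)],
   a convex combination of [y] and the points [-e_p], [e_p]. *)
Lemma convex_lower_bound (R : realType) (m n : nat) (h : 'M[R]_(m, n) -> R) :
  convex_modulus 0 h ->
  exists B : 'I_m * 'I_n -> R,
    forall y : 'M[R]_(m, n), h 0 - \sum_p B p * `|y p.1 p.2| <= h y.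
Proof.
move=> ch; pose E (p : 'I_m * 'I_n) : 'M[R]_(m, n) := delta_mx p.1 p.2.
pose M p := `|h (E p)| + `|h (- E p)|.
exists (fun p => M p - h 0) => y.
(* [S r] and [X r] are the total weight and the unnormalized point once the coordinates in [r] are
   treated. *)
pose S (r : seq ('I_m * 'I_n)) := 1 + \sum_(p <- r) `|y p.1 p.2|.
pose X (r : seq ('I_m * 'I_n)) := y - \sum_(p <- r) y p.1 p.2 *: E p.
have S_gt0 r : 0 < S r by rewrite ltr_pwDl // sumr_ge0.
have step r : S r * h ((S r)^-1 *: X r) <= h y + \sum_(p <- r) M p * `|y p.1 p.2|.
  elim: r => [|p r IH].
    by rewrite /S /X !big_nil subr0 !addr0 invr1 scale1r mul1r.
  (* The sign is chosen so that adding [|y_p| e] cancels coordinate [p]. *)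
  pose e := if 0 <= y p.1 p.2 then - E p else E p.
  have Xe : X (p :: r) = X r + `|y p.1 p.2| *: e.
    rewrite /X /e big_cons; case: ifPn => [y0|]; last rewrite -ltNge => y0.
      by rewrite ger0_norm // scalerN opprD addrCA [LHS]addrC.
    by rewrite ltr0_norm // scaleNr opprD addrCA [LHS]addrC.
  have Se : S (p :: r) = S r + `|y p.1 p.2|.
    by rewrite /S big_cons addrCA [LHS]addrC.
  have he : h e <= M p.
    rewrite /e /M; case: ifP => _; apply: le_trans (ler_norm _) _.
      by rewrite lerDr.
    by rewrite lerDl.
  rewrite Xe Se big_cons; apply: le_trans (convex_perspective _ _ ch _ _) _ => //.
  rewrite addrCA addrC; apply: lerD => //.
  by rewrite mulrC ler_wpM2r.
have := step (index_enum _).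
have -> : X (index_enum _) = 0.
  apply/eqP; rewrite subr_eq0; apply/eqP.
  by rewrite [LHS]matrix_sum_delta pair_bigA.
rewrite scaler0 /S; under [X in _ -> _ - X <= _]eq_bigr do rewrite mulrBl.
by rewrite sumrB -mulr_sumr; lra.
Qed.

(** Without its quadratic part, [F] decreases at most linearly in the [|y_p|]; completing the square
    in each coordinate absorbs this at the cost of [B p ^+ 2 / (2 * mu)]. *)
Lemma strongly_convex_bounded_below (R : realType) (m n : nat) (mu : R)
    (F : 'M[R]_(m, n) -> R) : 0 < mu -> convex_modulus mu F ->
  exists c, forall y, c <= F y.
Proof.
move=> mu0 /convex_modulusB/convex_lower_bound[B hB].
exists (F 0 - mu / 2 * dot (0 : 'M[R]_(m, n)) 0 - \sum_p B p ^+ 2 / (2 * mu)) => y.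
have : 0 <= \sum_p (mu / 2 * (y p.1 p.2 * y p.1 p.2) - B p * `|y p.1 p.2| +
                    B p ^+ 2 / (2 * mu)).
  apply: sumr_ge0 => p _.
  rewrite -expr2 -(real_normK (num_real (y p.1 p.2))).
  move: (B p) `|_| => b t.
  have -> : mu / 2 * t ^+ 2 - b * t + b ^+ 2 / (2 * mu) =
    (mu * t - b) ^+ 2 / (2 * mu) by field; rewrite gt_eqF.
  by rewrite divr_ge0 ?sqr_ge0 // mulr_ge0 // ltW.
rewrite big_split sumrB /= -mulr_sumr -dot_pairE.
have := hB y; lra.
Qed.

(** * Limits of minimizing sequences *)

Lemma cvg_dot (R : realType) (m n : nat) (x y : nat -> 'M[R]_(m, n))
    (x' y' : 'M[R]_(m, n)) :
  (forall i j, x k i j @[k --> \oo] --> x' i j) ->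
  (forall i j, y k i j @[k --> \oo] --> y' i j) ->
  dot (x k) (y k) @[k --> \oo] --> dot x' y'.
Proof.
move=> xx yy; rewrite dot_pairE; under eq_fun do rewrite dot_pairE.
apply: cvg_big => [|p _]; first exact: add_continuous.
by apply: cvgM; [exact: xx|exact: yy].
Qed.

Lemma cvg_coord_linear (R : realType) (m n p q : nat)
    (A : {linear 'M[R]_(m, n) -> 'M[R]_(p, q)})
    (x : nat -> 'M[R]_(m, n)) (x' : 'M[R]_(m, n)) :
  (forall i j, x k i j @[k --> \oo] --> x' i j) ->
  forall i j, A (x k) i j @[k --> \oo] --> A x' i j.
Proof.
move=> xx i j.
have AE z : A z i j = \sum_s z s.1 s.2 * A (delta_mx s.1 s.2) i j.
  rewrite [in LHS](matrix_sum_delta z) pair_bigA linear_sum summxE.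
  by apply: eq_bigr => s _; rewrite linearZ mxE.
rewrite AE; under eq_fun do rewrite AE.
apply: cvg_big => [|s _]; first exact: add_continuous.
by apply: cvgM; [exact: xx|exact: cvg_cst].
Qed.

Lemma sqr_diff_le_harmonic_cvg (R : realType) (a : nat -> R) (C : R) :
  (forall j k, (a j - a k) ^+ 2 <= C * (harmonic j + harmonic k)) ->
  cvg (a @ \oo).
Proof.
move=> aC; have C0 : 0 <= C.
  have := aC 0%N 0%N; rewrite subrr expr0n /= => h.
  by rewrite -(pmulr_lge0 _ (_ : 0 < harmonic 0 + harmonic 0)) ?addr_gt0 ?harmonic_gt0.
apply/cauchy_cvgP/cauchy_exP => e e0.
(* The [+ 1] covers [C = 0]; past [N] the given bound is at most [2 * C * harmonic N < e ^+ 2]. *)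
have d0 : 0 < e ^+ 2 / (2 * C + 1).
  by rewrite divr_gt0 ?exprn_gt0 //; lra.
have [N _ /(_ N (leqnn N)) /= HN] := near_infty_natSinv_lt (PosNum d0).
exists (a N); exists N => // k /= Nk; rewrite /ball /=.
rewrite -(ltr_pXn2r (_ : 0 < 2)%N) ?nnegrE ?(ltW e0) // real_normK ?num_real //.
apply: le_lt_trans (aC N k) _; rewrite ltr_pdivlMr in HN; last lra.
apply: le_lt_trans HN; rewrite mulrC.
have hk : harmonic k <= harmonic N :> R by rewrite lef_pV2 ?posrE // ler_nat.
have h0 : 0 <= harmonic N :> R by exact: harmonic_ge0.
apply: (@le_trans _ _ ((harmonic N + harmonic N) * C)).
  by rewrite ler_wpM2r // lerD2l.
rewrite -[_^-1]/(harmonic N : R); move: (harmonic N) h0 => r r0; lra.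
Qed.

(* Strong convexity along the segment between two almost minimal points bounds
   their distance, so that minimizing sequences are Cauchy. *)
Lemma minimizing_sequence_cvg (R : realType) (m n : nat) (mu : R)
    (F : 'M[R]_(m, n) -> R) (K : set 'M[R]_(m, n)) (c : R) :
  0 < mu -> convex_modulus mu F ->
  (forall x y t, 0 <= t -> t <= 1 -> K x -> K y -> K (t *: x + (1 - t) *: y)) ->
  (forall y, K y -> c <= F y) ->
  (forall e, 0 < e -> exists2 y, K y & F y <= c + e) ->
  exists (z : nat -> 'M[R]_(m, n)) (y : 'M[R]_(m, n)),
    [/\ forall k, K (z k), forall k, F (z k) <= c + harmonic k &
        forall i j, z k i j @[k --> \oo] --> y i j].
Proof.
move=> mu0 cF cK lbF infF.
have /choice[z Hz] (k : nat) : exists y, K y /\ F y <= c + harmonic k.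
  by have [y Ky Fy] := infF _ (@harmonic_gt0 R k); exists y.
(* At the midpoint, [c <= c + (harmonic j + harmonic k) / 2 - mu / 8 * |z j - z k|^2], whence the
   factor [4 / mu]. *)
have zz j k : dot (z j - z k) (z j - z k) <= 4 / mu * (harmonic j + harmonic k).
  have [[Kj Fj] [Kk Fk]] := (Hz j, Hz k).
  rewrite mulrAC ler_pdivlMr //.
  have h0 : 0 <= 2^-1 :> R by lra.
  have h1 : 2^-1 <= 1 :> R by lra.
  have := lbF _ (cK _ _ _ h0 h1 Kj Kk); have := cF (z j) (z k) _ h0 h1.
  lra.
have cz i j : cvg ((fun k => z k i j) @ \oo).
  apply: (@sqr_diff_le_harmonic_cvg _ _ (4 / mu)) => k k'.
  apply: le_trans (zz k k').
  by have := sqr_coord_le_dot (z k - z k') i j; rewrite !mxE.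
exists z, (\matrix_(i, j) lim ((fun k => z k i j) @ \oo)); split.
- by move=> k; case: (Hz k).
- by move=> k; case: (Hz k).
- by move=> i j; rewrite mxE; exact: cz.
Qed.

(** This is the limit [t -> 0]: if [b < a], some [t] with [t * c <= (a - b) / 2] gives a
    contradiction. *)
Lemma le_of_lt1_perturb (R : realType) (a b c : R) :
  (forall t, 0 < t -> t < 1 -> a <= b + t * c) -> a <= b.
Proof.
move=> H; rewrite leNgt; apply/negP => ba.
have d0 : 0 < `|c| + (a - b) by rewrite ltr_wpDl // subr_gt0.
have := H ((a - b) / (2 * (`|c| + (a - b)))).
have t0 : 0 < (a - b) / (2 * (`|c| + (a - b))) by rewrite divr_gt0 //; lra.
have t1 : (a - b) / (2 * (`|c| + (a - b))) < 1.
  by rewrite ltr_pdivrMr; have := normr_ge0 c; lra.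
move=> /(_ t0 t1).
have -> : (a - b) / (2 * (`|c| + (a - b))) * c =
          (a - b) * (c / (2 * (`|c| + (a - b)))) by rewrite mulrAC mulrA.
have : c / (2 * (`|c| + (a - b))) <= 2^-1.
  rewrite ler_pdivrMr; last lra.
  by have := ler_norm c; lra.
by rewrite -(ler_pM2l (_ : 0 < a - b)) ?subr_gt0 //; lra.
Qed.

(** Apply the modulus inequality between [w k] and [z k], let [k] go to infinity, divide by [t],
    then let [t] go to [0]. Values of [F] are taken only along the sequences, never at their
    limits. *)
Lemma strong_growth_limit (R : realType) (m n : nat) (mu : R)
    (F : 'M[R]_(m, n) -> R) (K : set 'M[R]_(m, n)) (c s : R)
    (z w : nat -> 'M[R]_(m, n)) (y y' : 'M[R]_(m, n)) (b : nat -> R) :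
  convex_modulus mu F ->
  (forall x y t, 0 <= t -> t <= 1 -> K x -> K y -> K (t *: x + (1 - t) *: y)) ->
  (forall y, K y -> c <= F y) ->
  (forall k, K (z k)) -> (forall k, F (z k) <= c + harmonic k) ->
  (forall i j, z k i j @[k --> \oo] --> y i j) ->
  (forall k, K (w k)) -> (forall k, F (w k) <= b k) -> b @ \oo --> s ->
  (forall i j, w k i j @[k --> \oo] --> y' i j) ->
  c + mu / 2 * dot (y' - y) (y' - y) <= s.
Proof.
move=> cF cK lbF Kz Fz zy Kw Fw bs wy.
set D := dot _ _; apply: (@le_of_lt1_perturb _ _ _ (mu / 2 * D)) => t t0 t1.
have : c <= t * s + (1 - t) * (c + 0) - mu / 2 * (t * (1 - t) * D).
  pose r k := t * b k + (1 - t) * (c + harmonic k) -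
     mu / 2 * (t * (1 - t) * dot (w k - z k) (w k - z k)).
  apply: (@ler_cvg_to _ \oo _ _ (cst c) r); first exact: cvg_cst.
    apply: cvgB.
      apply: cvgD; first by apply: cvgMr.
      by apply: cvgMr; apply: cvgD; [exact: cvg_cst|exact: cvg_harmonic].
    apply: cvgMr; apply: cvgMr.
    have wz i j : (w k - z k) i j @[k --> \oo] --> (y' - y) i j.
      rewrite !mxE; under eq_fun do rewrite !mxE.
      by apply: cvgB; [exact: wy|exact: zy].
    exact: cvg_dot.
  near=> k; rewrite /cst /r.
  apply: le_trans (lbF _ (cK (w k) (z k) t _ _ _ _)) _ => //; try exact: ltW.
  apply: le_trans (cF _ _ _ (ltW t0) (ltW t1)) _.
  rewrite lerD2r lerD // ler_wpM2l //; lra.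
rewrite addr0 -subr_ge0.
have -> : t * s + (1 - t) * c - mu / 2 * (t * (1 - t) * D) - c =
   t * (s + t * (mu / 2 * D) - (c + mu / 2 * D)) by ring.
by rewrite pmulr_rge0 // subr_ge0.
Unshelve. all: by end_near. Qed.

(** * Differentiability from a quadratic remainder *)

(** Links the Euclidean norm to the max norm, in which the library measures differentiability. *)
Lemma dot_le_norm (R : realType) (p q : nat) (h : 'M[R]_(p, q)) :
  dot h h <= (p * q)%:R * `|h| ^+ 2.
Proof.
rewrite dot_pairE.
have -> : (p * q)%:R * `|h| ^+ 2 = \sum_(s : 'I_p * 'I_q) `|h| ^+ 2.
  by rewrite sumr_const card_prod !card_ord mulr_natl.
apply: ler_sum => s _; rewrite -expr2 -real_normK ?num_real //.
rewrite lerXn2r ?nnegrE // {2}/Num.norm /= mx_normrE.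
exact: (le_bigmax_cond _ (fun s => `|h s.1 s.2|)).
Qed.

Lemma dot_continuous (R : realType) (p q : nat) (v : 'M[R]_(p, q)) :
  continuous (fun h : 'M[R]_(p, q) => dot h v : R).
Proof.
move=> x; rewrite /continuous_at dot_pairE; under eq_fun do rewrite dot_pairE.
apply: cvg_big => [||s _]; [exact: add_continuous|exact: nbhs_filter|].
apply: cvgM; [exact: nbhs_filter|exact: coord_continuous|].
apply: cvg_cst; exact: nbhs_filter.
Qed.

Lemma differentiable_norm_sqr_bound (R : realType) (V W : normedModType R)
    (f : V -> W) (df : {linear V -> W}) (x : V) (C : R) :
  continuous df ->
  (forall h, `|f (h + x) - f x - df h| <= C * `|h| ^+ 2) ->
  differentiable f x /\ 'd f x = df :> (V -> W).
Proof.
move=> dfc fC.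
have fdf : f \o shift x = cst (f x) + df +o_ 0 id.
  apply/eqaddoP => e e0; have C0 : 0 < `|C| + 1 by rewrite ltr_wpDl.
  near=> h; rewrite opprD addrA; apply: le_trans (fC h) _.
  have : `|h| <= e / (`|C| + 1).
    (* This radius forces [C * |h| <= e], also when [C = 0]. *)
    near: h; apply/nbhs_normP; exists (e / (`|C| + 1)); first exact: divr_gt0.
    by move=> h; rewrite /= sub0r normrN => /ltW.
  rewrite ler_pdivlMr // => hC.
  rewrite expr2 mulrA ler_wpM2r //; apply: le_trans hC.
  by rewrite mulrC ler_wpM2l // (le_trans (ler_norm C)) // lerDl.
have dE := diff_unique dfc fdf.
by split => //; apply/diff_locallyP; rewrite dE.
Unshelve. all: by end_near. Qed.

Lemma differentiable_quadratic_bound (R : realType) (p q : nat)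
    (g : 'M[R]_(p, q) -> R) (l v : 'M[R]_(p, q)) (C : R) :
  (forall h, `|g (h + l) - g l - dot h v| <= C * dot h h) ->
  differentiable g l /\ gradient g l = v.
Proof.
move=> gC.
pose d : 'M[R]_(p, q) -> R := fun h => dot h v.
have dlin : linear_for *:%R d.
  by move=> a x y; rewrite /d dotDl dotZl.
pose dL := GRing.isLinear.Build _ _ _ _ _ dlin.
pose df : {linear 'M[R]_(p, q) -> R} := HB.pack d dL.
have dfc : continuous df by exact: dot_continuous.
have [dg dE] : differentiable g l /\ 'd g l = df :> ('M[R]_(p, q) -> R).
  apply: (@differentiable_norm_sqr_bound _ _ _ _ _ _ (`|C| * (p * q)%:R)) => // h.
  apply: le_trans (gC h) _; apply: (@le_trans _ _ (`|C| * dot h h)).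
    by rewrite ler_wpM2r ?dot_ge0 // ler_norm.
  by rewrite -mulrA ler_wpM2l // dot_le_norm.
split => //; apply/matrixP => i j; rewrite mxE deriveE // dE /=.
rewrite /d /dot (bigD1 i) //= (bigD1 j) //= mxE !eqxx mul1r.
rewrite big1 ?addr0 => [|k kj]; last by rewrite mxE (negbTE kj) andbF mul0r.
rewrite big1 ?addr0 // => k ki; rewrite big1 // => k' _.
by rewrite mxE (negbTE ki) mul0r.
Qed.

(** * Smoothness of the dual function *)

(** [g] enters only through the two properties of an infimum, which keeps extended reals out of the
    argument. *)
Lemma dual_gradient_lipschitz (R : realType) (m n p q : nat) (mu c : R)
    (F : 'M[R]_(m, n) -> R) (A : {linear 'M[R]_(m, n) -> 'M[R]_(p, q)})
    (K : set 'M[R]_(m, n)) (g : 'M[R]_(p, q) -> R) :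
  0 < mu -> convex_modulus mu F ->
  (forall x y t, 0 <= t -> t <= 1 -> K x -> K y -> K (t *: x + (1 - t) *: y)) ->
  0 <= c -> (forall y, dot (A y) (A y) <= c * dot y y) ->
  (forall l y, K y -> g l <= F y + dot l (A y)) ->
  (forall l e, 0 < e -> exists2 y, K y & F y + dot l (A y) <= g l + e) ->
  (forall l, differentiable g l) /\ euclidean_lipschitz (c / mu) (gradient g).
Proof.
move=> mu0 cF cK c0 Ac lbF infF.
have cFl l : convex_modulus mu (fun y => F y + dot l (A y)).
  exact: convex_modulusD_dot.
have /choice[z /choice[s Hs]] l :=
  minimizing_sequence_cvg mu0 (cFl l) cK (lbF l) (infF l).
have growth l l' :
    g l + mu / 2 * dot (s l' - s l) (s l' - s l) <= g l' + dot (l - l') (A (s l')).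
  have [[Kz Fz zs] [Kw Fw ws]] := (Hs l, Hs l').
  (* Changing the multiplier from [l'] to [l] adds [dot (l - l') (A (z l' k))] to the objective. *)
  pose b k := g l' + harmonic k + dot (l - l') (A (z l' k)).
  apply: (strong_growth_limit (b := b) (cFl l) cK (lbF l) Kz Fz zs Kw _ _ ws).
    by move=> k; have := Fw k; rewrite /b dotDl dotNl; lra.
  rewrite -[g l' in X in _ --> X]addr0; apply: cvgD.
    by apply: cvgD; [exact: cvg_cst|exact: cvg_harmonic].
  by apply: cvg_dot; [move=> i j; exact: cvg_cst|exact: cvg_coord_linear].
pose k := c / mu; have k0 : 0 <= k by rewrite divr_ge0 // ltW.
(* Cocoercivity: add [growth l l'] and [growth l' l], then bound [A] by [c]. *)
have coco l l' : dot (A (s l') - A (s l)) (A (s l') - A (s l)) <=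
    k * dot (l - l') (A (s l') - A (s l)).
  have := Ac (s l' - s l); rewrite linearB /= => /le_trans; apply.
  have := growth l l'; have := growth l' l.
  rewrite -(opprB (s l') (s l)) -(opprB l l') !dotNl dotNr opprK.
  rewrite (dotDr (l - l')) (dotNr (l - l')) => h1 h2.
  rewrite /k mulrAC ler_pdivlMr // -mulrA ler_wpM2l //; lra.
(* Expand [0 <= |A (s l' - s l) - k (l - l')|^2] and use [coco]. *)
have lip l l' : dot (A (s l') - A (s l)) (A (s l') - A (s l)) <=
    k ^+ 2 * dot (l - l') (l - l').
  have := coco l l'; have := dot_ge0 (A (s l') - A (s l) - k *: (l - l')).
  move: (A (s l') - A (s l)) (l - l') => u v.
  rewrite !(dotDl, dotDr, dotNl, dotNr, dotZl, dotZr) (dotC u v); lra.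
have dgrad l : differentiable g l /\ gradient g l = A (s l).
  (* With [u = A (s (h + l)) - A (s l)], the two [growth] inequalities place the remainder between
     [dot h u] and [0]; [0 <= |h + u|^2] and [lip] bound [- dot h u] by
     [(1 + k ^+ 2) / 2 * |h|^2]. *)
  apply: (@differentiable_quadratic_bound _ _ _ _ _ _ (1 + k ^+ 2)) => h.
  have := growth (h + l) l; have := growth l (h + l).
  have := lip l (h + l).
  have -> : h + l - l = h by rewrite addrK.
  have -> : l - (h + l) = - h by rewrite opprD addrCA subrr addr0.
  have := dot_ge0 (h + (A (s (h + l)) - A (s l))).
  have := mulr_ge0 (ltW mu0) (dot_ge0 (s l - s (h + l))).
  have := mulr_ge0 (ltW mu0) (dot_ge0 (s (h + l) - s l)).
  rewrite (dotNl h (A _)) (dotNl h (- h)) dotNr opprK.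
  set u := A (s (h + l)) - A (s l).
  have -> : dot h (A (s (h + l))) = dot h u + dot h (A (s l)).
    by rewrite -dotDr subrK.
  rewrite (dotDl h u) !(dotDr _ h u) (dotC u h) => p1 p2 p3 p4 p5 p6.
  by rewrite ler_norml; apply/andP; split; have := dot_ge0 h; nra.
split => [l|l l']; first by case: (dgrad l).
have [[_ ->] [_ ->]] := (dgrad l, dgrad l').
rewrite -(ler_pXn2r (_ : 0 < 2)%N) ?nnegrE ?(mulr_ge0 k0) ?sqrtr_ge0 //.
rewrite exprMn !enorm_sqr; have := lip l' l.
by rewrite -(opprB l l') dotNl dotNr opprK.
Qed.

Theorem proposition1 (R : realType) (m n : nat)
  (hm : (2 <= m)%N) (hn : (1 <= n)%N)
  (Y : set 'rV[R]_n)
  (Y_nonempty : Y !=set0) (Y_closed : closed Y) (Y_convex : convex_set Y)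
  (f : 'I_m -> 'rV[R]_n -> R)
  (f_strict : forall i, strictly_convex (f i))
  (f_closed : forall i, closed_function (f i))
  (mus : 'I_m -> R)
  (f_strong : forall i, strongly_convex (mus i) (f i))
  (mu : R)
  (mu_min : (exists i, mu = mus i) /\ (forall i, mu <= mus i)) :
  let g := fun l : 'M[R]_(m.-1, n) => fine (dual_function Y f l) in
  (forall l : 'M[R]_(m.-1, n), dual_function Y f l \is a fin_num) /\
  (forall l : 'M[R]_(m.-1, n), differentiable g l) /\
  euclidean_lipschitz (1 / mu * (2 + 2 * cos (pi / m%:R))) (gradient g).
Proof.
move=> g.
have [[i0 mu_i0] mu_le] := mu_min.
have mu0 : 0 < mu by rewrite mu_i0; case: (f_strong i0).
pose K : set 'M[R]_(m, n) := [set y | forall i, Y (row i y)].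
have cK x y t : 0 <= t -> t <= 1 -> K x -> K y -> K (t *: x + (1 - t) *: y).
  move=> t0 t1 Kx Ky i.
  have -> : row i (t *: x + (1 - t) *: y) = t *: row i x + (1 - t) *: row i y.
    by rewrite linearD !linearZ.
  have t01 : Itv.spec (@Itv.num_sem R) (Itv.Real `[0%Z, 1%Z]) t.
    by rewrite /= /Itv.num_sem /= num_real in_itv /= t0 t1.
  have := @Y_convex (row i x) (row i y) (Itv.mk t01).
  by rewrite !inE; apply; [exact: Kx|exact: Ky].
have cF : convex_modulus mu (separable_sum f).
  by apply: convex_modulus_separable_sum mu_le => i; exact: strongly_convex_modulus.
pose A : {linear 'M[R]_(m, n) -> 'M[R]_(m.-1, n)} := @consecutive_diff R m n.
(* Strong convexity bounds the infimum below and the point with all rows [y0] bounds it above, so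
   [fine] never returns its default [0] for an infinite value. *)
have fin l : dual_function Y f l \is a fin_num.
  have [c Hc] := strongly_convex_bounded_below mu0 (convex_modulusD_dot A l cF).
  have [y0 Yy0] := Y_nonempty; pose y : 'M[R]_(m, n) := \matrix_(i < m) y0.
  have Ky : K y by move=> i; rewrite /= rowK.
  rewrite fin_numElt; apply/andP; split.
    apply: (@lt_le_trans _ _ c%:E); first exact: ltNyr.
    by apply: le_ereal_inf_tmp => _ [x _ <-]; rewrite lee_fin.
  apply: le_lt_trans (ltry (separable_sum f y + dot l (consecutive_diff y))).
  by apply: ereal_inf_lbound; exists y.
have lb l y : K y -> g l <= separable_sum f y + dot l (A y).
  move=> Ky; rewrite -lee_fin /g fineK //.
  by apply: ereal_inf_lbound; exists y.
have adh l e : 0 < e -> exists2 y, K y & separable_sum f y + dot l (A y) <= g l + e.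
  move=> e0; have [_ [y Ky <-]] := lb_ereal_inf_adherent e0 (fin l).
  rewrite -/(dual_function Y f l) -(fineK (fin l)) -EFinD lte_fin => /ltW le.
  by exists y.
have m0 : (0 < m)%N by exact: ltnW.
have c0 : 0 <= 2 + 2 * cos (pi / m%:R) :> R.
  by have := cos_geN1 (pi / m%:R : R); lra.
have [dg lip] := dual_gradient_lipschitz mu0 cF cK c0
  (fun y => dot_consecutive_diff_le y m0) lb adh.
by split => //; split => //; rewrite div1r mulrC.
Qed.
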